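(* Suppose Assumptions 1, 2 (that is, 2a or 2b), 3 and 4 listed in the context hold, and let $\gamma>0$ satisfy $\gamma=O(p\sqrt{\log p/n})$. For a $p\times p$ diagonal scaling matrix $\hat D$ with nonzero diagonal entries, used in both estimators, let $$\hat\Omega^{\text{MPI}}(\hat D)=\sigma^2 n\hat M\hat M^\top\ \text{ with }\ \hat M=\hat D X^\top(XX^\top)^{-1},\qquad \hat\Omega^{\text{RID}}(\hat D)=\sigma^2 n\hat M\hat M^\top\ \text{ with }\ \hat M=\hat D(X^\top X+\gamma I_p)^{-1}X^\top .$$ Then, almost surely, for every $j=1,\dots,p$, $$\hat\Omega_{jj}^{\text{RID}}(\hat D)-\hat\Omega_{jj}^{\text{MPI}}(\hat D)<0 .$$
   Context: Setting: $y=X\beta+\varepsilon$, where $y$ is an $n\times1$ response, $X$ is a random $n\times p$ regressor matrix with $p>n$, $\beta\in\mathbb R^p$ is the unknown coefficient vector, and $\varepsilon$ is the $n\times 1$ error vector. $\hat\Omega_{jj}$ is the ($n$-scaled, conditional on $X$) variance of the $j$-th entry of the debiased estimator $\hat M y-(\hat MX-I_p)\hat\beta^{\text{lasso}}$, ignoring its bias term. The scaling matrices of interest in the paper are $\hat D_{jj}=[e_j^\top X^\top(XX^\top)^{-1}Xe_j]^{-1}$ and $\hat D_{jj}=[e_j^\top(X^\top X+\gamma I_p)^{-1}X^\top Xe_j]^{-1}$; the same $\hat D$ is used in both variances being compared. Asymptotics are along $n\to\infty$ with $p=p_n$. ''Constant'' means independent of $n$ and $p$, $\sigma>0$ is a constant,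 and ''subgaussian'' means with subgaussian norm bounded by a constant. $\mathcal O(p)$ is the set of $p\times p$ orthogonal matrices, $\|\beta\|_0$ is the number of nonzero entries of $\beta$, and $\overset{(d)}{=}$ is equality in distribution. $XX^\top$ is taken to be almost surely invertible. Assumption 1. $C_1\log p<n<C_2p$ for some sufficiently large constant $C_1>0$ and a constant $C_2<1$. The sparsity $s_0=\|\beta\|_0$ satisfies $s_0=o(\sqrt n/\log p)$. Assumption 2a. $R$ is an $n\times p$ matrix with independent subgaussian rows $r_i=(\Sigma^R)^{1/2}\tilde r_i$, where $\tilde r_i$ has independent subgaussian elements; $\Sigma^R=E[r_ir_i^\top]$ satisfies $\max_{i=1,\dots,p}\Sigma^R_{ii}=O(1)$ and $1/\lambda_{\min}(\Sigma^R)=O(1)$. Moreover $X=R$. Assumption 2b. $F$ is an $n\times k$ matrix with independent rows and identically subgaussian distributed columns; $\Lambda$ is a $p\times k$ matrix with identically subgaussian distributed columns, and $\Sigma^\Lambda=E[\Lambda\Lambda^\top]$ has finite eigenvalues bounded away from zero by a constant. $X=F\Lambda^\top+R$ with $k$ fixed, $R$, $F$, $\Lambda$ independent, and $R$ as described in Assumption 2a (apart from $X=R$) with additionally $\lambda_{\max}(\Sigma^R)<M$ for a constant $M$. Assumption 3. The rows of $X$ are spherically symmetric: the rows of $R$ satisfy $r_i\overset{(d)}{=}Tr_i$ and, in the case of a factor structure (2b), the columns $\lambda_i$ of $\Lambda$ also satisfy $\lambda_i\overset{(d)}{=}T\lambda_i$, for any fixed $T\in\mathcal O(p)$. This is understood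 in the form that the law of $X$ is invariant under right multiplication: $XT\overset{(d)}{=}X$ for every fixed $T\in\mathcal O(p)$. Assumption 4. $\varepsilon\sim N(0,\sigma^2I_n)$ and $\varepsilon$ is independent of $X$. *)

(* Defs.v *)
From HB Require Import structures.
From mathcomp Require Import all_boot all_order all_algebra.
From mathcomp Require Import all_classical all_reals all_analysis.

Set Implicit Arguments.
Unset Strict Implicit.
Unset Printing Implicit Defensive.

Import Order.TTheory GRing.Theory Num.Theory.
Import numFieldNormedType.Exports.

Local Open Scope classical_set_scope.
Local Open Scope ring_scope.

Definition borel (E : topologicalType) : set (set E) := <<s [set A | open A] >>.
Arguments borel : clear implicits.

Definition random_element (d : measure_display) (T : measurableType d)
    (E : topologicalType) (f : T -> E) : Prop :=
  forall B, borel E B -> measurable (f @^-1` B).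

Definition sigma_of (T : Type) (E : topologicalType) (f : T -> E) :
    set (set T) :=
  preimage_set_system setT f (borel E).

Definition eq_in_law (d : measure_display) (T : measurableType d) (R : realType)
    (P : probability T R) (E : topologicalType) (f g : T -> E) : Prop :=
  forall B, borel E B -> P (f @^-1` B) = P (g @^-1` B).

(* The product rule over the whole family contains the product rule over every
   subfamily when all the set systems contain [setT], which is the case for
   [sigma_of f]. *)
Definition independent (d : measure_display) (T : measurableType d)
    (R : realType) (P : probability T R) (I : finType)
    (G : I -> set (set T)) : Prop :=
  forall A : I -> set T, (forall i, G i (A i)) ->
    P (\bigcap_(i in [set: I]) A i) = (\prod_(i : I) P (A i))%E.

(* inf {t > 0 : E[exp(f^2 / t^2)] <= 2}, equal to [+oo] when there is no such t. *)
Definition psi2_norm (d : measure_display) (T : measurableType d) (R : realType)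
    (P : probability T R) (f : T -> R) : \bar R :=
  ereal_inf [set t%:E | t in
    [set t : R | 0 < t /\ ('E_P[fun w => expR ((f w / t) ^+ 2)] <= 2%:E)%E]].

Definition psi2_norm_rV (d : measure_display) (T : measurableType d)
    (R : realType) (P : probability T R) (m : nat) (f : T -> 'rV[R]_m) : \bar R :=
  ereal_sup [set psi2_norm P (fun w => (f w *m u^T) 0 0) | u in
    [set u : 'rV[R]_m | (u *m u^T) 0 0 = 1]].

Definition orthogonal_mx (R : realType) (p : nat) (Q : 'M[R]_p) : Prop :=
  Q *m Q^T = 1%:M.

Definition lambda_min (R : realType) (p : nat) (A : 'M[R]_p) : R :=
  inf [set a | eigenvalue A a].

Definition lambda_max (R : realType) (p : nat) (A : 'M[R]_p) : R :=
  sup [set a | eigenvalue A a].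

(* [S] is the symmetric positive semidefinite square root of [A]. *)
Definition is_sqrt_mx (R : realType) (p : nat) (A S : 'M[R]_p) : Prop :=
  [/\ S^T = S, (forall v : 'rV[R]_p, 0 <= (v *m S *m v^T) 0 0) & S *m S = A].

Definition mpi_mx (R : realType) (n p : nat) (D : 'M[R]_p) (X : 'M[R]_(n, p)) :
    'M[R]_(p, n) :=
  D *m X^T *m invmx (X *m X^T).

Definition rid_mx (R : realType) (n p : nat) (gamma : R) (D : 'M[R]_p)
    (X : 'M[R]_(n, p)) : 'M[R]_(p, n) :=
  D *m invmx (X^T *m X + gamma%:M) *m X^T.

Definition Omega (R : realType) (n p : nat) (sigma : R) (M : 'M[R]_(p, n)) :
    'M[R]_p :=
  (sigma ^+ 2 * n%:R) *: (M *m M^T).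

Definition Omega_mpi (R : realType) (n p : nat) (sigma : R) (X : 'M[R]_(n, p))
    (D : 'M[R]_p) : 'M[R]_p :=
  Omega sigma (mpi_mx D X).

Definition Omega_rid (R : realType) (n p : nat) (sigma gamma : R)
    (X : 'M[R]_(n, p)) (D : 'M[R]_p) : 'M[R]_p :=
  Omega sigma (rid_mx gamma D X).

Definition l0_norm (R : realType) (p : nat) (beta : 'cV[R]_p) : nat :=
  #|[pred a | beta a 0 != 0]|.

(* The models are indexed by [i], not by the sample size: the [i]-th model has
   sample size [n i], dimension [p i] and its own probability space, and
   asymptotic statements are along [i --> oo] with [n i --> oo]. A bound on the
   sizes required for large [n] is required here for all [i]. *)
Definition size_sparsity_condition (R : realType) (C1 C2 : R) (n p : nat -> nat)
    (beta : forall i, 'cV[R]_(p i)) : Prop :=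
  (forall i, C1 * ln (p i)%:R < (n i)%:R /\ (n i)%:R < C2 * (p i)%:R) /\
  (fun i => (l0_norm (beta i))%:R : R^o) =o_\oo
    (fun i => Num.sqrt (n i)%:R / ln (p i)%:R : R^o).

(* The vectors r_i and (Sigma^R)^(1/2) are handled as rows: the symmetric square
   root [S] acts on the right. *)
Definition subgaussian_matrix (d : measure_display) (T : measurableType d)
    (R : realType) (P : probability T R) (n p : nat) (K : R)
    (N : T -> 'M[R]_(n, p)) (Sigma : 'M[R]_p) : Prop :=
  [/\ random_element N,
      independent P (fun a : 'I_n => sigma_of (fun w => row a (N w))),
      (forall a, (psi2_norm_rV P (fun w => row a (N w)) <= K%:E)%E),
      (forall a b c, ('E_P[fun w => (N w a b * N w a c)%R] = (Sigma b c)%:E)%E) &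
      exists (S : 'M[R]_p) (Nt : T -> 'M[R]_(n, p)),
        [/\ is_sqrt_mx Sigma S,
            random_element Nt,
            (forall w a, row a (N w) = row a (Nt w) *m S),
            (forall a, independent P
               (fun b : 'I_p => sigma_of (fun w => Nt w a b : R))) &
            (forall a b, (psi2_norm P (fun w => Nt w a b) <= K%:E)%E)]].

Definition subgaussian_matrices (R : realType) (n p : nat -> nat)
    (d : nat -> measure_display) (T : forall i, measurableType (d i))
    (P : forall i, probability (T i) R)
    (N : forall i, T i -> 'M[R]_(n i, p i))
    (Sigma : forall i, 'M[R]_(p i)) : Prop :=
  [/\ (exists K : R, forall i, subgaussian_matrix (P i) K (N i) (Sigma i)),
      (fun i => \big[Num.max/0]_(a < p i) Sigma i a a : R^o) =O_\oo
        (fun _ => 1 : R^o),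
      (forall i, 0 < lambda_min (Sigma i)) &
      (fun i => ((lambda_min (Sigma i))^-1)%R : R^o) =O_\oo (fun _ => 1 : R^o)].

Definition subgaussian_design (R : realType) (n p : nat -> nat)
    (d : nat -> measure_display) (T : forall i, measurableType (d i))
    (P : forall i, probability (T i) R)
    (X : forall i, T i -> 'M[R]_(n i, p i)) : Prop :=
  exists (N : forall i, T i -> 'M[R]_(n i, p i))
         (SigmaR : forall i, 'M[R]_(p i)),
    subgaussian_matrices P N SigmaR /\ forall i w, X i w = N i w.

(* The columns of a random matrix are identically distributed subgaussian random
   vectors. *)
Definition iddist_subgaussian_columns (d : measure_display)
    (T : measurableType d) (R : realType) (P : probability T R) (m k : nat)
    (K : R) (F : T -> 'M[R]_(m, k)) : Prop :=
  (forall a b, eq_in_law P (fun w => col a (F w)) (fun w => col b (F w))) /\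
  (forall a, (psi2_norm_rV P (fun w => (col a (F w))^T) <= K%:E)%E).

(* Finiteness of the eigenvalues of E[Lambda Lambda^T] is the existence of this
   expectation as a real matrix. *)
Definition factor_design (R : realType) (n p : nat -> nat)
    (d : nat -> measure_display) (T : forall i, measurableType (d i))
    (P : forall i, probability (T i) R)
    (X : forall i, T i -> 'M[R]_(n i, p i)) : Prop :=
  exists (k : nat) (F : forall i, T i -> 'M[R]_(n i, k))
         (Lambda : forall i, T i -> 'M[R]_(p i, k))
         (N : forall i, T i -> 'M[R]_(n i, p i))
         (SigmaL SigmaR : forall i, 'M[R]_(p i)),
    [/\ (forall i w, X i w = F i w *m (Lambda i w)^T + N i w),
        (forall i, independent (P i) (tnth
           [tuple sigma_of (N i); sigma_of (F i); sigma_of (Lambda i)])),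
        [/\ (forall i, random_element (F i)),
            (forall i, independent (P i)
               (fun a : 'I_(n i) => sigma_of (fun w => row a (F i w)))) &
            exists K : R, forall i, iddist_subgaussian_columns (P i) K (F i)],
        [/\ (forall i, random_element (Lambda i)),
            (exists K : R,
               forall i, iddist_subgaussian_columns (P i) K (Lambda i)),
            (forall i a b, ('E_(P i)[fun w => ((Lambda i w *m (Lambda i w)^T) a b)%R]
               = (SigmaL i a b)%:E)%E) &
            exists2 c : R, 0 < c & forall i, c <= lambda_min (SigmaL i)] &
        subgaussian_matrices P N SigmaR /\
        exists M : R, forall i, lambda_max (SigmaR i) < M].

(* Invariance of the law of the whole matrix, not only of each row. *)
Definition spherically_symmetric (d : measure_display) (T : measurableType d)
    (R : realType) (P : probability T R) (n p : nat)
    (X : T -> 'M[R]_(n, p)) : Prop :=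
  forall Q : 'M[R]_p, orthogonal_mx Q -> eq_in_law P (fun w => X w *m Q) X.

(* [eps] has law N(0, sigma^2 I_n); the second parameter of [normal_prob] is the
   standard deviation. *)
Definition gaussian_noise (d : measure_display) (T : measurableType d)
    (R : realType) (P : probability T R) (n : nat) (sigma : R)
    (eps : T -> 'cV[R]_n) : Prop :=
  [/\ random_element eps,
      independent P (fun a : 'I_n => sigma_of (fun w => eps w a 0 : R)) &
      forall (a : 'I_n) (B : set R), borel R B ->
        P ((fun w => eps w a 0) @^-1` B) = normal_prob 0 sigma B].

(* Main.v *)
Require Import Defs.
From HB Require Import structures.
From mathcomp Require Import all_boot all_order all_algebra.
From mathcomp Require Import all_classical all_reals all_analysis.
From mathcomp Require Import ring.

(** The inequality holds pointwise whenever [X X^T] is invertible and no column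
    of [X] vanishes, and these conditions hold almost surely.

    Write [W = X X^T].  The push-through identity
    [(X^T X + g)^-1 X^T = X^T (W + g)^-1] ([ridge_push_through]) puts both
    scaling matrices in the form [D X^T B], with [B = W^-1] for the
    pseudoinverse and [B = (W + g)^-1] for ridge.  Since [D] is diagonal, the
    [j]-th variance is a positive multiple, the same for both estimators, of
    the squared norm of [v B], where [v] is the [j]-th column of [X] written as
    a row.  As [0 < W < W + g], the ridge norm is strictly smaller as soon as
    [v != 0] ([sqnorm_ridge_lt], [Omega_rid_lt_mpi]).

    It remains to see that almost surely no column of [X] vanishes, which is
    where rotational invariance is used ([column_neq0_ae]).  Fix two columns
    [X_a] and [X_b].  Each unit vector [q] of the plane of the two coordinates
    is the image of the first one under some reflection, so the events
    [X q = 0] all have the same probability.  Two of them, for linearly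
    independent vectors, meet exactly in the event that [X_a] and [X_b] both
    vanish.  Removing this common part leaves infinitely many disjoint events of
    equal probability, which is therefore zero: almost surely, if [X_a]
    vanishes then so does [X_b] ([column_eq0_propagates]).  Hence a vanishing
    column forces [X = 0], which contradicts the invertibility of [W] because
    [n > 0]. *)

Import Order.TTheory GRing.Theory Num.Theory.
Import numFieldNormedType.Exports.

Set Implicit Arguments.
Unset Strict Implicit.

Local Open Scope classical_set_scope.
Local Open Scope ring_scope.

(** * Ridge regularization shrinks the rows of the scaling matrix *)

Definition sqnorm (R : realType) (m : nat) (u : 'rV[R]_m) : R :=
  (u *m u^T) 0 0.

Lemma sqnormE (R : realType) (m : nat) (u : 'rV[R]_m) :
  sqnorm u = \sum_k u 0 k ^+ 2.
Proof. by rewrite /sqnorm mxE; apply: eq_bigr => k _; rewrite mxE expr2. Qed.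

Lemma sqnorm_ge0 (R : realType) (m : nat) (u : 'rV[R]_m) : 0 <= sqnorm u.
Proof. by rewrite sqnormE sumr_ge0 // => k _; rewrite sqr_ge0. Qed.

Lemma sqnorm_eq0 (R : realType) (m : nat) (u : 'rV[R]_m) :
  sqnorm u = 0 -> u = 0.
Proof.
rewrite sqnormE => /psumr_eq0P u0; apply/rowP => k; rewrite mxE.
by apply/eqP; rewrite -sqrf_eq0 u0 // => j _; rewrite sqr_ge0.
Qed.

Lemma sqnormZ (R : realType) (m : nat) (a : R) (u : 'rV[R]_m) :
  sqnorm (a *: u) = a ^+ 2 * sqnorm u.
Proof.
by rewrite /sqnorm linearZ /= -scalemxAl -scalemxAr scalerA mxE expr2.
Qed.

Lemma sqnormD (R : realType) (m : nat) (u v : 'rV[R]_m) :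
  sqnorm (u + v) = sqnorm u + 2 * (u *m v^T) 0 0 + sqnorm v.
Proof.
have uv : (v *m u^T) 0 0 = (u *m v^T) 0 0.
  by rewrite -{2}(trmxK u) -trmx_mul [RHS]mxE.
have entryD (A B : 'M[R]_1) : (A + B) 0 0 = A 0 0 + B 0 0 by rewrite mxE.
rewrite /sqnorm linearD mulmxDl !mulmxDr !entryD /= uv.
by ring.
Qed.

(** If [u] is in the kernel then [|u A|^2 + g |u|^2 = 0], so [u = 0]. *)
Lemma gram_regularized_unit (R : realType) (m q : nat) (A : 'M[R]_(m, q))
  (g : R) : 0 < g -> A *m A^T + g%:M \in unitmx.
Proof.
move=> g0; rewrite -row_free_unit; apply: inj_row_free => u u0.
have : sqnorm (u *m A) + g * sqnorm u = 0.
  transitivity ((u *m (A *m A^T + g%:M) *m u^T) 0 0).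
    rewrite mulmxDr mulmxDl mul_mx_scalar -scalemxAl [RHS]mxE [X in _ = _ + X]mxE.
    by rewrite /sqnorm trmx_mul !mulmxA.
  by rewrite u0 mul0mx mxE.
move/eqP; rewrite paddr_eq0 ?sqnorm_ge0 // ?mulr_ge0 ?sqnorm_ge0 ?ltW //.
by case/andP=> _; rewrite mulf_eq0 gt_eqF //= => /eqP /sqnorm_eq0.
Qed.

Lemma ridge_push_through (R : realType) (n p : nat) (X : 'M[R]_(n, p))
  (g : R) : 0 < g ->
  invmx (X^T *m X + g%:M) *m X^T = X^T *m invmx (X *m X^T + g%:M).
Proof.
move=> g0.
have U1 : X *m X^T + g%:M \in unitmx by apply: gram_regularized_unit.
have U2 : X^T *m X + g%:M \in unitmx.
  by have := gram_regularized_unit X^T g0; rewrite trmxK.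
apply: (canRL (mulmxK U1)).
rewrite -mulmxA; apply: (canLR (mulKmx U2)).
by rewrite mulmxDl mulmxDr mulmxA mul_scalar_mx mul_mx_scalar.
Qed.

(** With [z = v (W + g)^-1] and [x = z W^-1], clearing the inverses gives
    [v W^-1 = z + g x]; the cross term [z x^T = x W x^T = |x X|^2] is
    nonnegative, so the norm grows by at least [g^2 |x|^2]. *)
Lemma sqnorm_ridge_lt (R : realType) (n p : nat) (X : 'M[R]_(n, p)) (g : R)
  (v : 'rV[R]_n) : 0 < g -> X *m X^T \in unitmx -> v != 0 ->
  sqnorm (v *m invmx (X *m X^T + g%:M)) < sqnorm (v *m invmx (X *m X^T)).
Proof.
move=> g0 UW v0.
have UWg : X *m X^T + g%:M \in unitmx by apply: gram_regularized_unit.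
set z := v *m invmx (X *m X^T + g%:M).
pose x := z *m invmx (X *m X^T).
have zE : z = x *m (X *m X^T) by rewrite mulmxKV.
have vE : v = z *m (X *m X^T + g%:M) by rewrite mulmxKV.
have x0 : x != 0.
  by apply: contraNneq v0 => x0; rewrite vE zE x0 !mul0mx.
have -> : v *m invmx (X *m X^T) = z + g *: x.
  by rewrite {1}vE mulmxDr mulmxDl mulmxK // mul_mx_scalar -scalemxAl.
have zx : (z *m x^T) 0 0 = sqnorm (x *m X).
  by rewrite zE /sqnorm (trmx_mul x X) !mulmxA.
rewrite sqnormD linearZ /= -scalemxAr [X in 2 * X]mxE zx sqnormZ -addrA ltrDl.
rewrite ltr_wpDl ?mulr_ge0 ?sqnorm_ge0 ?ltW // mulr_gt0 ?exprn_gt0 //.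
by rewrite lt0r sqnorm_ge0 andbT; apply: contra_neq x0; exact: sqnorm_eq0.
Qed.

Lemma Omega_scaled_diag (R : realType) (n p : nat) (s : R) (D : 'M[R]_p)
  (B : 'M[R]_(p, n)) (j : 'I_p) : is_diag_mx D ->
  Omega s (D *m B) j j = s ^+ 2 * n%:R * D j j ^+ 2 * sqnorm (row j B).
Proof.
move=> /is_diag_mxP Dd.
have rowDB : row j (D *m B) = D j j *: row j B.
  apply/rowP => k; rewrite !mxE (bigD1 j) //= big1 ?addr0 // => l lj.
  by rewrite Dd ?mul0r // eq_sym.
rewrite -[RHS]mulrA -sqnormZ -rowDB /Omega mxE; congr (_ * _).
rewrite sqnormE mxE; apply: eq_bigr => k _.
by rewrite [_^T _ _]mxE [row _ _ _ _]mxE expr2.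
Qed.

Lemma Omega_rid_lt_mpi (R : realType) (n p : nat) (s g : R)
  (X : 'M[R]_(n, p)) (D : 'M[R]_p) (j : 'I_p) :
  (0 < n)%N -> 0 < s -> 0 < g -> X *m X^T \in unitmx ->
  is_diag_mx D -> D j j != 0 -> col j X != 0 ->
  Omega_rid s g X D j j < Omega_mpi s X D j j.
Proof.
move=> n0 s0 g0 UW Dd Dj Xj.
rewrite /Omega_rid /Omega_mpi /rid_mx /mpi_mx -!mulmxA ridge_push_through //.
rewrite !Omega_scaled_diag // !row_mul ltr_pM2l; last first.
  by rewrite mulr_gt0 ?exprn_even_gt0 // mulr_gt0 ?exprn_gt0 ?ltr0n.
apply: sqnorm_ridge_lt => //; apply: contra_neq Xj => /(congr1 trmx).
by rewrite tr_row trmxK trmx0.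
Qed.

(** * Reflections in a coordinate plane *)

(** The Householder reflection in the hyperplane orthogonal to [u]; acting with
    reflections avoids completing a vector to an orthonormal basis. *)
Definition reflection_mx (R : realType) (p : nat) (u : 'rV[R]_p) : 'M[R]_p :=
  1%:M - (2 / sqnorm u) *: (u^T *m u).

Lemma reflection_mx_orthogonal (R : realType) (p : nat) (u : 'rV[R]_p) :
  u != 0 -> orthogonal_mx (reflection_mx u).
Proof.
move=> u0; have nu0 : sqnorm u != 0 by apply: contra_neq u0 => /sqnorm_eq0.
have uu : u^T *m u *m (u^T *m u) = sqnorm u *: (u^T *m u).
  by rewrite mulmxA -(mulmxA _ u) [u *m _]mx11_scalar mul_mx_scalar scalemxAl.
have sym : (reflection_mx u)^T = reflection_mx u.
  by apply/matrixP => i j; rewrite !mxE !big_ord1 !mxE eq_sym [u 0 j * _]mulrC.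
rewrite /orthogonal_mx sym /reflection_mx.
rewrite mulmxBl mul1mx mulmxBr mulmx1 -scalemxAl -scalemxAr uu !scalerA.
move: (u^T *m u) (sqnorm u) nu0 => P c c0.
by apply/matrixP => i j; rewrite !mxE; field.
Qed.

(** The slope [k] parametrizes the directions of the plane rationally, so that
    no square root or angle is needed to normalize them. *)
Lemma col_mul_reflection (R : realType) (n p : nat) (M : 'M[R]_(n, p))
  (a b : 'I_p) (k : R) : a != b ->
  col a (M *m reflection_mx (k *: 'e_a - 'e_b)) =
  (1 + k ^+ 2)^-1 *: ((1 - k ^+ 2) *: col a M + (2 * k) *: col b M).
Proof.
move=> ab; set u := _ - _.
have nu : sqnorm u = 1 + k ^+ 2.
  rewrite sqnormE (bigD1 a) //= (bigD1 b) 1?eq_sym //= big1 ?addr0.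
    by rewrite !mxE !eqxx (negPf ab) eq_sym (negPf ab) /= mulr1n mulr0n; ring.
  by move=> i /andP[/negPf ia /negPf ib]; rewrite !mxE ia ib /= mulr0 subr0 expr0n.
have k0 : 1 + k ^+ 2 != 0 by rewrite gt_eqF // ltr_pwDl // sqr_ge0.
have Mu : M *m u^T = k *: col a M - col b M.
  by rewrite linearB /= linearZ /= mulmxBr -scalemxAr !trmx_delta -!colE.
have ua : u 0 a = k by rewrite !mxE !eqxx (negPf ab) /= mulr1n mulr0n; ring.
rewrite /reflection_mx nu mulmxBr mulmx1 -scalemxAr mulmxA Mu.
apply/colP => i; rewrite !mxE big_ord1 ua !mxE; field.
exact: k0.
Qed.

(** * Almost surely no column vanishes *)

Definition columns_dependent (R : realType) (n p : nat) (a b : 'I_p)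
    (c e : R) : set 'M[R]_(n, p) :=
  [set M | c *: col a M + e *: col b M = 0].

(** The set is closed: finitely many entries depend continuously on the matrix
    and must vanish. *)
Lemma borel_columns_dependent (R : realType) (n p : nat) (a b : 'I_p)
  (c e : R) : borel 'M[R]_(n, p) (columns_dependent a b c e).
Proof.
have -> : columns_dependent a b c e = \bigcap_(i in [set: 'I_n])
    ((fun M : 'M[R]_(n, p) => c * M i a + e * M i b) @^-1` [set x : R | x = 0]).
  apply/seteqP; split => M; rewrite /columns_dependent /=.
    by move=> /colP M0 i _ /=; have := M0 i; rewrite !mxE.
  by move=> M0; apply/colP => i; have := M0 i Logic.I; rewrite !mxE.
rewrite -[X in borel _ X]setCK -setTD; apply: sigma_algebraCD.
apply: sub_sigma_algebra => /=; apply: closed_openC; apply: closed_bigI => i _.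
have cont : continuous (fun M : 'M[R]_(n, p) => c * M i a + e * M i b : R).
  move=> M; have cM j := @coord_continuous R n p i j M.
  exact: (cvgD (cvgMl_tmp (cM a)) (cvgMl_tmp (cM b))).
by move/continuous_closedP : cont; apply; exact: closed_eq.
Qed.

Lemma probability_disjoint_const (d : measure_display) (T : measurableType d)
  (R : realType) (P : probability T R) (A : nat -> set T) (c : \bar R) :
  (forall k, measurable (A k)) -> trivIset [set: nat] A ->
  (forall k, P (A k) = c) -> c = 0%E.
Proof.
move=> mA tA PA.
have c0 : (0 <= c)%E by rewrite -(PA 0%N).
have cfin : c \is a fin_num by rewrite -(PA 0%N) fin_num_measure.
rewrite -(fineK cfin) in c0 PA *; set r := fine c in c0 PA *.
rewrite lee_fin in c0.
suff : r <= 0 by move=> r0; congr _%:E; apply/eqP; rewrite eq_le r0.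
rewrite leNgt; apply/negP => r0.
have bound_le k : k%:R * r <= 1.
  rewrite -lee_fin.
  have <- : P (\big[setU/set0]_(i < k) A i) = (k%:R * r)%:E.
    rewrite measure_bigsetU // (eq_bigr (fun=> r%:E)) => [|i _]; last exact: PA.
    by rewrite sumEFin sumr_const card_ord mulr_natl.
  by apply: (@probability_le1 _ _ _ P); apply: bigsetU_measurable.
have := bound_le (Num.bound r^-1); rewrite leNgt -ltr_pdivrMr // div1r.
move=> /negP; apply.
by rewrite archi_boundP // invr_ge0 ltW.
Qed.

(** The events [A k] that [(1 - k^2) X_a + 2 k X_b = 0], for natural [k], have
    the probability of [X_a = 0] by invariance under the reflection of slope
    [k], and any two of them intersect in the same event [B]. *)
Lemma column_eq0_propagates (d : measure_display) (T : measurableType d)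
  (R : realType) (P : probability T R) (n p : nat) (X : T -> 'M[R]_(n, p))
  (a b : 'I_p) : random_element X -> spherically_symmetric P X ->
  {ae P, forall w, col a (X w) = 0 -> col b (X w) = 0}.
Proof.
move=> mX sX.
have [->|ab] := eqVneq a b; first by apply: aeW.
pose A (k : nat) := X @^-1` columns_dependent a b (1 - k%:R ^+ 2) (2 * k%:R).
pose B := [set w | col a (X w) = 0 /\ col b (X w) = 0].
have mA k : measurable (A k) by apply: mX; exact: borel_columns_dependent.
have coef0 k l (w : T) : k != l -> A k w -> A l w -> B w.
  move=> kl; rewrite /A /columns_dependent /= => Ak Al.
  have {}kl : (k%:R - l%:R : R) != 0 by rewrite subr_eq0 eqr_nat.
  have kl0 : (1 + k%:R * l%:R : R) != 0 by rewrite gt_eqF // ltr_pwDl // mulr_ge0.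
  suff aux i : X w i a = 0 /\ X w i b = 0.
    by split; apply/colP => i; rewrite !mxE; case: (aux i).
  have := congr1 (fun M : 'cV_n => M i 0) Ak.
  have := congr1 (fun M : 'cV_n => M i 0) Al.
  rewrite !mxE; move: (X w i a) (X w i b) => x y e1 e2.
  have det0 : (k%:R - l%:R) * (1 + k%:R * l%:R) != 0 :> R by rewrite mulf_neq0.
  (* Cramer's rule: the determinant of the two equations is [-2] times the
     nonzero product [det0]. *)
  split; apply: (mulfI det0); rewrite mulr0.
    transitivity (k%:R * ((1 - l%:R ^+ 2) * x + 2 * l%:R * y)
       - l%:R * ((1 - k%:R ^+ 2) * x + 2 * k%:R * y)); first by ring.
    by rewrite e1 e2 !mulr0 subr0.
  transitivity (2^-1 * ((1 - l%:R ^+ 2) * ((1 - k%:R ^+ 2) * x + 2 * k%:R * y)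
     - (1 - k%:R ^+ 2) * ((1 - l%:R ^+ 2) * x + 2 * l%:R * y))); first by field.
  by rewrite e1 e2 !mulr0 subr0 mulr0.
have BA k : B `<=` A k.
  by move=> w [Xa Xb]; rewrite /A /columns_dependent /= Xa Xb !scaler0 addr0.
have BE : B = A 0%N `&` A 1%N.
  apply/seteqP; split => [w Bw|w [A0 A1]]; first by split; apply: BA.
  exact: (coef0 0 1)%N.
have mB : measurable B by rewrite BE; apply: measurableI.
have A0E : A 0%N = [set w | col a (X w) = 0].
  by apply/seteqP; split => w; rewrite /A /columns_dependent /=;
    rewrite mulr0 scale0r addr0 expr0n subr0 scale1r.
have PA k : P (A k) = P (A 0%N).
  pose u : 'rV[R]_p := k%:R *: 'e_a - 'e_b.
  have u0 : u != 0.
    apply/eqP => /rowP /(_ b); rewrite !mxE !eqxx eq_sym (negPf ab) /=.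
    by move/eqP; rewrite mulr0 sub0r oppr_eq0 pnatr_eq0.
  rewrite -(sX _ (reflection_mx_orthogonal u0) _
    (borel_columns_dependent a b (1 - 0%:R ^+ 2) (2 * 0%:R))).
  congr (P _); apply/seteqP; split => w; rewrite /A /columns_dependent /=;
   rewrite mulr0 scale0r addr0 expr0n subr0 scale1r col_mul_reflection //.
    by move=> ->; rewrite scaler0.
  move/eqP; rewrite scaler_eq0 invr_eq0 gt_eqF ?ltr_pwDl ?sqr_ge0 //=.
  by move/eqP.
have null : (P (A 0%N `\` B) = 0)%E.
  have PAB k : P (A k `\` B) = (P (A 0%N) - P B)%E.
    transitivity (P (A k) - P (A k `&` B))%E.
      by apply: measureD => //; rewrite -ge0_fin_numE ?fin_num_measure.
    by rewrite (setIidr (BA k)) (PA k).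
  rewrite PAB; apply: (@probability_disjoint_const _ _ _ P (fun k => A k `\` B)).
  - by move=> k; apply: measurableD.
  - apply/trivIsetP => k l _ _ kl; rewrite -subset0 => w [[Ak nB] [Al _]].
    exact/nB/(coef0 k l).
  - exact: PAB.
exists (A 0%N `\` B); split => //; first exact: measurableD.
move=> w; rewrite A0E /B /= => /not_implyP[Xa Xb]; split => // -[_ /Xb].
by [].
Qed.

(** If one column vanishes then all do, and [0] is not invertible in positive
    dimension. *)
Lemma column_neq0_ae (d : measure_display) (T : measurableType d)
  (R : realType) (P : probability T R) (n p : nat) (X : T -> 'M[R]_(n, p))
  (a : 'I_p) : (0 < n)%N -> random_element X -> spherically_symmetric P X ->
  {ae P, forall w, X w *m (X w)^T \in unitmx} ->
  {ae P, forall w, col a (X w) != 0}.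
Proof.
move=> n0 mX sX UX.
have all0 : {ae P, forall w, forall b, col a (X w) = 0 -> col b (X w) = 0}.
  by apply: filter_forall => b; exact: column_eq0_propagates.
apply: filterS2 UX all0 => w Uw aw; apply/eqP => Xa.
have X0 : X w = 0.
  by apply/matrixP => i j; have /colP/(_ i) := aw j Xa; rewrite !mxE.
move: Uw; rewrite X0 mul0mx => /mulmxV; rewrite mul0mx => /matrixP.
move=> /(_ (Ordinal n0) (Ordinal n0)) /eqP.
by rewrite !mxE eqxx eq_sym oner_eq0.
Qed.

(** * Comparison of the two variances *)

Theorem theorem3 (R : realType)
  (n p : nat -> nat)
  (d : nat -> measure_display) (T : forall i, measurableType (d i))
  (P : forall i, probability (T i) R)
  (X : forall i, T i -> 'M[R]_(n i, p i))
  (beta : forall i, 'cV[R]_(p i))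
  (eps y : forall i, T i -> 'cV[R]_(n i))
  (sigma C1 C2 : R)
  (gamma : nat -> R)
  (D : forall i, T i -> 'M[R]_(p i)) :
  (n @ \oo --> \oo) ->
  (forall i, (n i < p i)%N) ->
  (forall i, random_element (X i)) ->
  (forall i w, y i w = X i w *m beta i + eps i w) ->
  (forall i, {ae P i, forall w, X i w *m (X i w)^T \in unitmx}) ->
  0 < sigma -> 0 < C1 -> C2 < 1 ->
  size_sparsity_condition C1 C2 n beta ->
  (subgaussian_design P X \/ factor_design P X) ->
  (forall i, spherically_symmetric (P i) (X i)) ->
  (forall i, gaussian_noise (P i) sigma (eps i)) ->
  (forall i, independent (P i) (tnth
     [tuple sigma_of (eps i); sigma_of (X i)])) ->
  (forall i, 0 < gamma i) ->
  gamma =O_\oo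
    (fun i => (p i)%:R * Num.sqrt (ln (p i)%:R / (n i)%:R) : R^o) ->
  (forall i, {ae P i, forall w,
     is_diag_mx (D i w) /\ forall j, D i w j j != 0}) ->
  forall i, {ae P i, forall w, forall j : 'I_(p i),
    Omega_rid sigma (gamma i) (X i w) (D i w) j j -
    Omega_mpi sigma (X i w) (D i w) j j < 0}.
Proof.
move=> _ np mX _ UX s0 C1_gt0 _ [size_cond _] _ sX _ _ g0 _ DD i.
have n0 : (0 < n i)%N.
  (* [p > n] gives [ln p >= 0], and [C1 ln p < n] then excludes [n = 0]. *)
  rewrite -(ltr0n R); apply: le_lt_trans (size_cond i).1.
  by rewrite mulr_ge0 ?ln_ge0 ?ler1n ?(leq_ltn_trans _ (np i)) ?(ltW C1_gt0).
have Xcol : {ae P i, forall w, forall j : 'I_(p i), col j (X i w) != 0}.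
  by apply: filter_forall => j; apply: column_neq0_ae.
apply: filterS3 (UX i) (DD i) Xcol => w Uw [Dd Dn0] Xn0 j.
by rewrite subr_lt0; apply: Omega_rid_lt_mpi.
Qed.
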